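(* Let $m$ and $n$ be non-negative integers and let $j$, $r$, $s$ be any integers. Then \[ \sum_{k = 0}^n (-1)^k\binom nk F_{j(2rk + s)}^{2m + 1} = \begin{cases} (-1)^n 5^{-m} \sum_{i = 0}^m (-1)^{i(js + 1)} \binom{2m + 1}{i} L_{(2m + 1 - 2i)jr}^n F_{(2m + 1 - 2i)(jrn + js)}, & jr \text{ odd},\\ 5^{n/2 - m} \sum_{i = 0}^m (-1)^{i(js + 1)} \binom{2m + 1}{i} F_{(2m + 1 - 2i)jr}^n F_{(2m + 1 - 2i)(jrn + js)}, & jr \text{ even},\ n \text{ even},\\ -5^{(n - 1)/2 - m} \sum_{i = 0}^m (-1)^{i(js + 1)} \binom{2m + 1}{i} F_{(2m + 1 - 2i)jr}^n L_{(2m + 1 - 2i)(jrn + js)}, & jr \text{ even},\ n \text{ odd}, \end{cases} \] and \[ \sum_{k = 0}^n (-1)^k\binom nk L_{j(2rk + s)}^{2m + 1} = \begin{cases} (-1)^n \sum_{i = 0}^m (-1)^{ijs} \binom{2m + 1}{i} L_{(2m + 1 - 2i)jr}^n L_{(2m + 1 - 2i)(jrn + js)}, & jr \text{ odd},\\ 5^{n/2} \sum_{i = 0}^m (-1)^{ijs} \binom{2m + 1}{i} F_{(2m + 1 - 2i)jr}^n L_{(2m + 1 - 2i)(jrn + js)}, & jr \text{ even},\ n \text{ even},\\ -5^{(n + 1)/2} \sum_{i = 0}^m (-1)^{ijs} \binom{2m + 1}{i} F_{(2m + 1 - 2i)jr}^n F_{(2m + 1 - 2i)(jrn + js)}, &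 jr \text{ even},\ n \text{ odd}. \end{cases} \]
   Context: The Fibonacci numbers $F_n$ and Lucas numbers $L_n$ are defined for all integers $n$ by $F_0=0$, $F_1=1$, $L_0=2$, $L_1=1$, $F_n=F_{n-1}+F_{n-2}$, $L_n=L_{n-1}+L_{n-2}$, extended to negative indices by $F_{-n}=(-1)^{n-1}F_n$, $L_{-n}=(-1)^nL_n$. The convention $0^0=1$ is used. *)

(* Defs.v *)
From mathcomp Require Import all_boot all_order all_algebra.

Set Implicit Arguments.
Unset Strict Implicit.
Unset Printing Implicit Defensive.

Import Order.TTheory GRing.Theory Num.Theory.

Local Open Scope ring_scope.

Fixpoint fib (n : nat) : nat :=
  match n with
  | 0%N => 0%N
  | p.+1 => match p with 0%N => 1%N | q.+1 => (fib p + fib q)%N end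
  end.

Fixpoint lucas (n : nat) : nat :=
  match n with
  | 0%N => 2%N
  | p.+1 => match p with 0%N => 1%N | q.+1 => (lucas p + lucas q)%N end
  end.

(* [Negz p] is the integer -(p+1), so with n = p+1 the second branch reads
   F_(-n) = (-1)^(n-1) F_n. *)
Definition fibz (z : int) : int :=
  match z with
  | Posz n => (fib n)%:Z
  | Negz p => (-1) ^+ p * (fib p.+1)%:Z
  end.

(* With n = p+1 the second branch reads L_(-n) = (-1)^n L_n. *)
Definition lucasz (z : int) : int :=
  match z with
  | Posz n => (lucas n)%:Z
  | Negz p => (-1) ^+ p.+1 * (lucas p.+1)%:Z
  end.

(* Main.v *)
Require Import Defs.
From mathcomp Require Import all_boot all_order all_algebra all_field.
From mathcomp Require Import ring zify.
Import Order.TTheory GRing.Theory Num.Theory.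
Local Open Scope ring_scope.

(** With [e = 1] for Lucas and [e = -1] for Fibonacci numbers (scaled by the
    square root of 5), Binet's formulas read [G e N = alpha ^ N + e * beta ^ N].
    Pairing the terms [i] and [2m+1-i] of the binomial expansion turns an odd
    power [G e N ^+ (2m+1)] into a combination of the [G e (p N)], where
    [p = 2m+1-2i], reducing everything to first powers.
    There the alternating binomial sum collapses to powers of
    [1 - alpha ^ (2q)] and [1 - beta ^ (2q)], with [q = p j r].  As
    [alpha * beta = -1], these are, up to sign, [alpha ^ q * G e' q] and
    [beta ^ q * e' * G e' q] for [e' = - (-1) ^ q = - (-1) ^ (j r)], so one formula
    covers all the cases, which only differ by the values of [e'] and [e' ^+ n]. *)

(** * The golden ratio and its conjugate *)

Definition sqrt5 : algC := sqrtC 5%:R.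
Definition alpha : algC := (1 + sqrt5) / 2%:R.
Definition beta : algC := (1 - sqrt5) / 2%:R.

Lemma sqr_sqrt5 : sqrt5 ^+ 2 = 5%:R.
Proof. exact: sqrtCK. Qed.

Lemma sqrt5_neq0 : sqrt5 != 0.
Proof. by rewrite sqrtC_eq0 pnatr_eq0. Qed.

Lemma alphaD_beta : alpha + beta = 1.
Proof. by rewrite /alpha /beta; field. Qed.

Lemma alphaB_beta : alpha - beta = sqrt5.
Proof. by rewrite /alpha /beta; field. Qed.

Lemma alphaM_beta : alpha * beta = -1.
Proof.
have -> : alpha * beta = (1 - sqrt5 ^+ 2) / 4%:R.
  by rewrite /alpha /beta; field.
by rewrite sqr_sqrt5; field.
Qed.

Lemma alpha_neq0 : alpha != 0.
Proof.
apply/eqP => a0; move/eqP: alphaM_beta.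
by rewrite a0 mul0r eq_sym oppr_eq0 oner_eq0.
Qed.

Lemma beta_neq0 : beta != 0.
Proof.
apply/eqP => b0; move/eqP: alphaM_beta.
by rewrite b0 mulr0 eq_sym oppr_eq0 oner_eq0.
Qed.

Lemma alphaV : alpha^-1 = - beta.
Proof.
by apply: (mulfI alpha_neq0); rewrite divff ?alpha_neq0 // mulrN alphaM_beta opprK.
Qed.

Lemma betaV : beta^-1 = - alpha.
Proof. by rewrite -[alpha]invrK alphaV invrN opprK. Qed.

Lemma alpha_rec n : alpha ^+ n.+2 = alpha ^+ n.+1 + alpha ^+ n.
Proof.
have a2 : alpha * alpha = alpha + 1.
  by rewrite -[in RHS](mulr1 alpha) -alphaD_beta mulrDr alphaM_beta alphaD_beta subrK.
by rewrite !exprS mulrA a2 mulrDl mul1r.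
Qed.

Lemma beta_rec n : beta ^+ n.+2 = beta ^+ n.+1 + beta ^+ n.
Proof.
have b2 : beta * beta = beta + 1.
  rewrite -[in RHS](mul1r beta) -alphaD_beta mulrDl alphaM_beta alphaD_beta.
  by rewrite addrC addrA subrr add0r.
by rewrite !exprS mulrA b2 mulrDl mul1r.
Qed.

(** * Binet's formulas for all integer indices *)

(* [binet (-1)] is [sqrt5] times the Fibonacci sequence and [binet 1] is the
   Lucas sequence. *)
Definition binet (e : algC) (z : int) : algC := alpha ^ z + e * beta ^ z.

Lemma binet_rec e (n : nat) :
  binet e n.+2 = binet e n.+1 + binet e n.
Proof. by rewrite /binet -!exprnP alpha_rec beta_rec; ring. Qed.

Lemma binet_fib (n : nat) : binet (-1) n = sqrt5 * (fib n)%:R.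
Proof.
suff [] : binet (-1) n = sqrt5 * (fib n)%:R /\ binet (-1) n.+1 = sqrt5 * (fib n.+1)%:R by [].
elim: n => [|n [IH1 IH2]].
  by rewrite /binet !expr0z !expr1z mulr1 subrr mulN1r alphaB_beta mulr0 mulr1.
by split=> //; rewrite binet_rec IH1 IH2 -mulrDr -natrD.
Qed.

Lemma binet_lucas (n : nat) : binet 1 n = (lucas n)%:R.
Proof.
suff [] : binet 1 n = (lucas n)%:R /\ binet 1 n.+1 = (lucas n.+1)%:R by [].
elim: n => [|n [IH1 IH2]].
  by rewrite /binet !expr0z !expr1z !mul1r alphaD_beta.
by split=> //; rewrite binet_rec IH1 IH2 -natrD.
Qed.

(** Since [alpha * beta = -1], a negative power of one root is a signed positive power of the other;
    this yields the sign rules for negative indices. *)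
Lemma alpha_Negz p : alpha ^ Negz p = (-1) ^+ p.+1 * beta ^+ p.+1.
Proof. by rewrite NegzE -exprnN -exprVn alphaV [LHS]exprNn. Qed.

Lemma beta_Negz p : beta ^ Negz p = (-1) ^+ p.+1 * alpha ^+ p.+1.
Proof. by rewrite NegzE -exprnN -exprVn betaV [LHS]exprNn. Qed.

Lemma binet_fibz (z : int) : binet (-1) z = sqrt5 * (fibz z)%:~R.
Proof.
case: z => p; first exact: binet_fib.
have -> : sqrt5 * (fibz (Negz p))%:~R = (-1) ^+ p * binet (-1) p.+1.
  by rewrite binet_fib rmorphM rmorphXn rmorphN1 mulrCA.
by rewrite /binet alpha_Negz beta_Negz -!exprnP [(-1) ^+ p.+1]exprS; ring.
Qed.

Lemma binet_lucasz (z : int) : binet 1 z = (lucasz z)%:~R.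
Proof.
case: z => p; first exact: binet_lucas.
have -> : (lucasz (Negz p))%:~R = (-1) ^+ p.+1 * binet 1 p.+1.
  by rewrite binet_lucas rmorphM rmorphXn rmorphN1.
by rewrite /binet alpha_Negz beta_Negz -!exprnP; ring.
Qed.

(** * Odd powers as combinations of first powers *)

(** The terms [i] and [2m+1-i] share their binomial coefficient and the factor [(x * y) ^+ i]; the
    odd exponent leaves no middle term. *)
Lemma exprD_odd (R : comRingType) (x y : R) m :
  (x + y) ^+ (2 * m + 1) =
  \sum_(0 <= i < m.+1) 'C(2 * m + 1, i)%:R * (x * y) ^+ i
     * (x ^+ (2 * m + 1 - 2 * i) + y ^+ (2 * m + 1 - 2 * i)).
Proof.
rewrite exprDn -(big_mkord xpredT (fun i => x ^+ (2 * m + 1 - i) * y ^+ i *+ 'C(2 * m + 1, i))).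
rewrite (big_cat_nat (n := m.+1)) /=; [|lia|lia].
(* The upper half is reindexed by [i -> 2m+1-i]. *)
have -> : \sum_(m.+1 <= i < (2 * m + 1).+1) x ^+ (2 * m + 1 - i) * y ^+ i *+ 'C(2 * m + 1, i)
   = \sum_(0 <= i < m.+1) x ^+ i * y ^+ (2 * m + 1 - i) *+ 'C(2 * m + 1, i).
  rewrite -{1}[m.+1]add0n big_addn.
  have -> : ((2 * m + 1).+1 - m.+1 = m.+1)%N by lia.
  rewrite big_nat_rev; apply: eq_big_nat => i Hi.
  have -> : (0 + m.+1 - i.+1 + m.+1 = 2 * m + 1 - i)%N by lia.
  by rewrite bin_sub ?subKn //; lia.
rewrite -big_split; apply: eq_big_nat => i Hi /=.
have -> : (2 * m + 1 - i = i + (2 * m + 1 - 2 * i))%N by lia.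
rewrite -mulrnDl -mulr_natl !exprD exprMn; ring.
Qed.

(** An odd power of [e] is [e] again, so each pair of terms is a value of the same [binet e]. *)
Lemma binet_odd_exp e N m : e ^+ 2 = 1 ->
  binet e N ^+ (2 * m + 1) =
  \sum_(0 <= i < m.+1) (e * (-1) ^ N) ^+ i * 'C(2 * m + 1, i)%:R
     * binet e ((2 * m%:Z + 1 - 2 * i%:Z) * N).
Proof.
move=> e2; rewrite /binet exprD_odd; apply: eq_big_nat => i Hi.
have p_odd : (2 * m + 1 - 2 * i = (2 * (m - i)).+1)%N by lia.
have -> : (2 * m%:Z + 1 - 2 * i%:Z) * N = N * (2 * m + 1 - 2 * i)%N by lia.
rewrite -!exprz_exp -!exprnP [(e * _) ^+ (2 * m + 1 - 2 * i)]exprMn {2}p_odd.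
rewrite exprS exprM e2 expr1n mulr1 mulrCA -expfzMl alphaM_beta.
by rewrite [_%:R * _]mulrC.
Qed.

(** * Alternating binomial sums *)

Lemma signz_double_add (K : fieldType) (w z : int) : (-1) ^ (2 * w + z) = (-1) ^ z :> K.
Proof.
by rewrite expfzDr ?oppr_eq0 ?oner_eq0 // -exprz_exp -exprnP sqrrN expr1n exp1rz mul1r.
Qed.

Lemma alphaM_beta_exp (q : int) : (-1) ^ q = alpha ^ q * beta ^ q.
Proof. by rewrite -expfzMl alphaM_beta. Qed.

Lemma alphaM_beta_sqr (q : int) : (alpha ^ q * beta ^ q) ^+ 2 = 1.
Proof. by rewrite -alphaM_beta_exp exprnP exprzAC -exprnP sqrrN expr1n exp1rz. Qed.

(** Replacing 1 by [(alpha ^ q * beta ^ q) ^+ 2] lets [alpha ^ q] factor out. The cofactor is the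
    same [binet] value as in the [beta] analogue. *)
Lemma subr1_alpha_sqr (q : int) :
  1 - alpha ^ (2 * q) = -1 * (alpha ^ q * binet (- (-1) ^ q) q).
Proof.
by rewrite /binet alphaM_beta_exp mulrC -exprz_exp -exprnP -[X in X - _](alphaM_beta_sqr q); ring.
Qed.

Lemma subr1_beta_sqr (q : int) :
  1 - beta ^ (2 * q) = (-1) ^ q * (beta ^ q * binet (- (-1) ^ q) q).
Proof.
rewrite /binet alphaM_beta_exp mulrC -exprz_exp -exprnP.
transitivity ((alpha ^ q * beta ^ q) ^+ 2 * (1 - (beta ^ q) ^+ 2)).
  by rewrite alphaM_beta_sqr mul1r.
ring.
Qed.

Lemma alt_sum_geom (x : algC) n :
  \sum_(0 <= k < n.+1) (-1) ^+ k * 'C(n, k)%:R * x ^+ k = (1 - x) ^+ n.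
Proof.
rewrite big_mkord exprDn; apply: eq_bigr => k _.
by rewrite expr1n mul1r [in RHS]exprNn -[RHS]mulr_natl mulrCA mulrA.
Qed.

(** Both geometric sums contain the n-th power of one [binet] value; the leftover [alpha ^ q] and
    [beta ^ q], raised to [n], shift the index by [q * n]. *)
Lemma alt_sum_binet e (q t : int) n :
  \sum_(0 <= k < n.+1) (-1) ^+ k * 'C(n, k)%:R * binet e (2 * q * k%:Z + t)
  = (-1) ^+ n * binet (- (-1) ^ q) q ^+ n * binet (e * (- (-1) ^ q) ^+ n) (q * n%:Z + t).
Proof.
have aux (x : algC) : x != 0 ->
    \sum_(0 <= k < n.+1) (-1) ^+ k * 'C(n, k)%:R * x ^ (2 * q * k%:Z + t)
    = x ^ t * (1 - x ^ (2 * q)) ^+ n.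
  move=> x0; rewrite -alt_sum_geom mulr_sumr; apply: eq_big_nat => k _.
  by rewrite expfzDr // -exprz_exp -exprnP mulrA mulrC.
transitivity (alpha ^ t * (1 - alpha ^ (2 * q)) ^+ n
              + e * (beta ^ t * (1 - beta ^ (2 * q)) ^+ n)).
  rewrite -!aux ?alpha_neq0 ?beta_neq0 // mulr_sumr -big_split /=.
  by apply: eq_big_nat => k _; rewrite /binet mulrDr [in RHS]mulrCA.
rewrite subr1_alpha_sqr subr1_beta_sqr /binet !expfzDr ?alpha_neq0 ?beta_neq0 //.
rewrite -!exprz_exp -!exprnP; set e' := - (-1) ^ q; rewrite -/(binet e' q).
(* This exposes a sign common to both terms and leaves [e' ^+ n] on the [beta] term only. *)
have s1 : (-1) ^ q = -1 * e' by rewrite mulN1r opprK.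
rewrite s1 !exprMn; ring.
Qed.

Lemma alt_sum_binet_odd_exp e m n (j r s : int) : e ^+ 2 = 1 ->
  let e' := - (-1) ^ (j * r) in
  \sum_(0 <= k < n.+1)
     (-1) ^+ k * 'C(n, k)%:R * binet e (j * (2 * r * k%:Z + s)) ^+ (2 * m + 1)
  = (-1) ^+ n * \sum_(0 <= i < m.+1)
      (e * (-1) ^ (j * s)) ^+ i * 'C(2 * m + 1, i)%:R
      * binet e' ((2 * m%:Z + 1 - 2 * i%:Z) * (j * r)) ^+ n
      * binet (e * e' ^+ n) ((2 * m%:Z + 1 - 2 * i%:Z) * (j * r * n%:Z + j * s)).
Proof.
move=> e2 e'.
under eq_big_nat => k _.
  rewrite binet_odd_exp // mulr_sumr.
  (* The sign does not depend on [k], so it leaves the inner sum once the summations are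
     exchanged. *)
  have -> : (-1) ^ (j * (2 * r * k%:Z + s)) = (-1) ^ (j * s) :> algC.
    have -> : j * (2 * r * k%:Z + s) = 2 * (j * r * k%:Z) + j * s by ring.
    by rewrite signz_double_add.
  over.
rewrite exchange_big_nat mulr_sumr; apply: eq_big_nat => i _ /=.
set p := 2 * m%:Z + 1 - 2 * i%:Z.
set c := (e * _) ^+ i * _.
(* As [p] is odd, [p * (j * r)] has the parity of [j * r]: [e'] is the same for every [i]. *)
have -> : e' = - (-1) ^ (p * (j * r)).
  congr (- _); have -> : p * (j * r) = 2 * ((m%:Z - i%:Z) * (j * r)) + j * r by rewrite /p; ring.
  by rewrite signz_double_add.
transitivity (c * \sum_(0 <= k < n.+1) (-1) ^+ k * 'C(n, k)%:R
        * binet e (2 * (p * (j * r)) * k%:Z + p * (j * s))).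
  rewrite mulr_sumr; apply: eq_big_nat => k _; rewrite mulrCA.
  by congr (_ * (_ * binet _ _)); ring.
rewrite alt_sum_binet.
have <- : p * (j * r) * n%:Z + p * (j * s) = p * (j * r * n%:Z + j * s) by ring.
by move: c => c; rewrite -!mulrA mulrCA.
Qed.

(** The case [e = -1], whose sign is absorbed into the exponent [j * s + 1]. The [binet] factors on
    the right await the parities of [j * r] and [n]. *)
Lemma sum_fibz_odd_exp m n (j r s : int) :
  sqrt5 ^+ (2 * m + 1) * \sum_(0 <= k < n.+1)
     (-1) ^+ k * 'C(n, k)%:R * (fibz (j * (2 * r * k%:Z + s)))%:~R ^+ (2 * m + 1)
  = (-1) ^+ n * \sum_(0 <= i < m.+1)
      (-1) ^ (i%:Z * (j * s + 1)) * 'C(2 * m + 1, i)%:R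
      * binet (- (-1) ^ (j * r)) ((2 * m%:Z + 1 - 2 * i%:Z) * (j * r)) ^+ n
      * binet (- (- (-1) ^ (j * r)) ^+ n) ((2 * m%:Z + 1 - 2 * i%:Z) * (j * r * n%:Z + j * s)).
Proof.
transitivity (\sum_(0 <= k < n.+1)
   (-1) ^+ k * 'C(n, k)%:R * binet (-1) (j * (2 * r * k%:Z + s)) ^+ (2 * m + 1)).
  by rewrite mulr_sumr; apply: eq_big_nat => k _; rewrite binet_fibz exprMn mulrCA.
rewrite alt_sum_binet_odd_exp ?sqrrN ?expr1n //; congr (_ * _).
apply: eq_big_nat => i _; rewrite -[in RHS](mulN1r ((- _) ^+ n)); congr (_ * _ * _ * _).
by rewrite [_ * (j * s + 1)]mulrC -(exprz_exp _ (j * s + 1)) expfzDr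
  ?oppr_eq0 ?oner_eq0 // expr1z [_ * -1]mulrC exprnP.
Qed.

Lemma sum_lucasz_odd_exp m n (j r s : int) :
  \sum_(0 <= k < n.+1)
     (-1) ^+ k * 'C(n, k)%:R * (lucasz (j * (2 * r * k%:Z + s)))%:~R ^+ (2 * m + 1)
  = (-1) ^+ n * \sum_(0 <= i < m.+1)
      (-1) ^ (i%:Z * (j * s)) * 'C(2 * m + 1, i)%:R
      * binet (- (-1) ^ (j * r)) ((2 * m%:Z + 1 - 2 * i%:Z) * (j * r)) ^+ n
      * binet ((- (-1) ^ (j * r)) ^+ n) ((2 * m%:Z + 1 - 2 * i%:Z) * (j * r * n%:Z + j * s)).
Proof.
transitivity (\sum_(0 <= k < n.+1)
   (-1) ^+ k * 'C(n, k)%:R * binet 1 (j * (2 * r * k%:Z + s)) ^+ (2 * m + 1)).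
  by apply: eq_big_nat => k _; rewrite binet_lucasz.
rewrite alt_sum_binet_odd_exp ?expr1n //; congr (_ * _).
apply: eq_big_nat => i _; rewrite !mul1r; congr (_ * _ * _ * _).
by rewrite [_ * (j * s)]mulrC -(exprz_exp _ (j * s)) exprnP.
Qed.

(** * Parity cases and descent to the rationals *)

Lemma signz_parity (K : fieldType) (z : int) :
  (-1) ^ z = (if (2 %| z)%Z then 1 else -1) :> K.
Proof.
have -> : z = 2 * (z %/ 2)%Z + (~~ (2 %| z)%Z)%:Z by lia.
rewrite signz_double_add; have -> : (2 %| 2 * (z %/ 2)%Z + (~~ (2 %| z)%Z)%:Z)%Z = (2 %| z)%Z by lia.
by case: (2 %| z)%Z; rewrite ?expr0z ?expr1z.
Qed.

Lemma sqrt5_exp n : sqrt5 ^+ n = (if odd n then sqrt5 else 1) * 5%:R ^+ n./2.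
Proof.
rewrite -{1}(odd_double_half n) exprD -mul2n exprM sqr_sqrt5.
by case: (odd n); rewrite ?expr1 ?expr0.
Qed.

(** Serves all six cases: [K] collects the powers of [sqrt5] released by Binet's formulas, leaving
    only constants to compare. *)
Lemma eq_scaled_sum (R : comPzRingType) (K a b : R) m n (c f g G B : nat -> R) :
  (forall i, G i ^+ n * B i = K * (f i ^+ n * g i)) -> a * K = b ->
  a * \sum_(0 <= i < m.+1) c i * G i ^+ n * B i
  = b * \sum_(0 <= i < m.+1) c i * f i ^+ n * g i.
Proof.
move=> GB <-; rewrite -mulrA; congr (_ * _).
by rewrite mulr_sumr; apply: eq_bigr => i _; rewrite -mulrA GB -mulrA mulrCA.
Qed.

Lemma ratr_alt_sum (f : nat -> int) n N :
  ratr (\sum_(0 <= k < n.+1) (-1) ^+ k * 'C(n, k)%:R * (f k)%:Q ^+ N)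
  = \sum_(0 <= k < n.+1) (-1) ^+ k * 'C(n, k)%:R * (f k)%:~R ^+ N :> algC.
Proof.
rewrite rmorph_sum; apply: eq_bigr => k _.
by rewrite !rmorphM /= !rmorphXn /= rmorphN1 ratr_nat ratr_int.
Qed.

Lemma ratr_sign_sum (u f g : nat -> int) m n N :
  ratr (\sum_(0 <= i < m.+1) (-1) ^ u i * 'C(N, i)%:R * (f i)%:Q ^+ n * (g i)%:Q)
  = \sum_(0 <= i < m.+1)
      (-1) ^ u i * 'C(N, i)%:R * (f i)%:~R ^+ n * (g i)%:~R :> algC.
Proof.
rewrite rmorph_sum; apply: eq_bigr => k _.
by rewrite !rmorphM /= rmorphXn /= fmorphXz rmorphN1 ratr_nat !ratr_int.
Qed.
Theorem theorem6 (m n : nat) (j r s : int) :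
  (\sum_(0 <= k < n.+1)
      (-1) ^+ k * 'C(n, k)%:R * (fibz (j * (2 * r * k%:Z + s)))%:Q ^+ (2 * m + 1)
   = if ~~ (2 %| j * r)%Z then
       (-1) ^+ n * 5%:Q ^ (- m%:Z) *
       \sum_(0 <= i < m.+1)
         (-1) ^ (i%:Z * (j * s + 1)) * 'C(2 * m + 1, i)%:R
         * (lucasz ((2 * m%:Z + 1 - 2 * i%:Z) * (j * r)))%:Q ^+ n
         * (fibz ((2 * m%:Z + 1 - 2 * i%:Z) * (j * r * n%:Z + j * s)))%:Q
     else if ~~ odd n then
       5%:Q ^ ((n %/ 2)%N%:Z - m%:Z) *
       \sum_(0 <= i < m.+1)
         (-1) ^ (i%:Z * (j * s + 1)) * 'C(2 * m + 1, i)%:R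
         * (fibz ((2 * m%:Z + 1 - 2 * i%:Z) * (j * r)))%:Q ^+ n
         * (fibz ((2 * m%:Z + 1 - 2 * i%:Z) * (j * r * n%:Z + j * s)))%:Q
     else
       - 5%:Q ^ (((n - 1) %/ 2)%N%:Z - m%:Z) *
       \sum_(0 <= i < m.+1)
         (-1) ^ (i%:Z * (j * s + 1)) * 'C(2 * m + 1, i)%:R
         * (fibz ((2 * m%:Z + 1 - 2 * i%:Z) * (j * r)))%:Q ^+ n
         * (lucasz ((2 * m%:Z + 1 - 2 * i%:Z) * (j * r * n%:Z + j * s)))%:Q
   :> rat)
  /\
  (\sum_(0 <= k < n.+1)
      (-1) ^+ k * 'C(n, k)%:R * (lucasz (j * (2 * r * k%:Z + s)))%:Q ^+ (2 * m + 1)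
   = if ~~ (2 %| j * r)%Z then
       (-1) ^+ n *
       \sum_(0 <= i < m.+1)
         (-1) ^ (i%:Z * (j * s)) * 'C(2 * m + 1, i)%:R
         * (lucasz ((2 * m%:Z + 1 - 2 * i%:Z) * (j * r)))%:Q ^+ n
         * (lucasz ((2 * m%:Z + 1 - 2 * i%:Z) * (j * r * n%:Z + j * s)))%:Q
     else if ~~ odd n then
       5%:Q ^+ (n %/ 2) *
       \sum_(0 <= i < m.+1)
         (-1) ^ (i%:Z * (j * s)) * 'C(2 * m + 1, i)%:R
         * (fibz ((2 * m%:Z + 1 - 2 * i%:Z) * (j * r)))%:Q ^+ n
         * (lucasz ((2 * m%:Z + 1 - 2 * i%:Z) * (j * r * n%:Z + j * s)))%:Q
     else
       - 5%:Q ^+ ((n + 1) %/ 2) *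
       \sum_(0 <= i < m.+1)
         (-1) ^ (i%:Z * (j * s)) * 'C(2 * m + 1, i)%:R
         * (fibz ((2 * m%:Z + 1 - 2 * i%:Z) * (j * r)))%:Q ^+ n
         * (fibz ((2 * m%:Z + 1 - 2 * i%:Z) * (j * r * n%:Z + j * s)))%:Q
   :> rat).
Proof.
have n5 : 5%:R ^+ m != 0 :> algC by rewrite expf_neq0 ?pnatr_eq0.
have r5 : ratr 5%:Q = 5%:R :> algC by rewrite ratr_int.
(* Both sides are rational, so equality may be tested after embedding in [algC]. *)
split; apply: (fmorph_inj (ratr : {rmorphism rat -> algC})) => /=.
  apply: (mulfI (expf_neq0 (2 * m + 1) sqrt5_neq0)).
  rewrite ratr_alt_sum sum_fibz_odd_exp signz_parity.
  have -> : sqrt5 ^+ (2 * m + 1) = sqrt5 * 5%:R ^+ m by rewrite addn1 exprS exprM sqr_sqrt5.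
  case: (2 %| j * r)%Z => /=; last first.
    (* Here [e' = 1]: the n-th powers are Lucas numbers and the last factor gives one [sqrt5]. *)
    rewrite !opprK expr1n rmorphM /= ratr_sign_sum mulrA.
    apply: (@eq_scaled_sum _ sqrt5) => [i|]; first by rewrite binet_lucasz binet_fibz mulrCA.
    rewrite rmorphM rmorphXn rmorphN1 fmorphXz /= r5 /= -exprnN -?exprnP.
    by field; exact: n5.
  (* Here [e' = -1]: the n-th powers are Fibonacci numbers and give [sqrt5 ^+ n]. The last factor is
     Fibonacci, with one more [sqrt5], exactly when [n] is even. *)
  rewrite -signr_odd; case: ifP => [n_even|/negbFE n_odd].
    rewrite rmorphM /= ratr_sign_sum mulrA (negbTE n_even).
    apply: (@eq_scaled_sum _ (sqrt5 ^+ n * sqrt5)) => [i|].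
      by rewrite !binet_fibz exprMn ?exprS; ring.
    rewrite sqrt5_exp (negbTE n_even) fmorphXz /= r5 /= expfzDr ?pnatr_eq0 // -exprnN -?exprnP divn2.
    by field; exact: n5.
  rewrite rmorphM /= ratr_sign_sum mulrA n_odd opprK.
  apply: (@eq_scaled_sum _ (sqrt5 ^+ n)) => [i|].
    by rewrite binet_fibz binet_lucasz exprMn; ring.
  rewrite sqrt5_exp n_odd rmorphN fmorphXz /= r5 /= expfzDr ?pnatr_eq0 // -exprnN -?exprnP.
  have -> : ((n - 1) %/ 2 = n./2)%N by lia.
  by field; exact: n5.
rewrite ratr_alt_sum sum_lucasz_odd_exp signz_parity.
case: (2 %| j * r)%Z => /=; last first.
  rewrite !opprK expr1n rmorphM /= ratr_sign_sum rmorphXn rmorphN1.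
  apply: (@eq_scaled_sum _ 1) => [i|]; last by rewrite mulr1.
  by rewrite !binet_lucasz mul1r.
(* Again [e' = -1], but now the last factor is Fibonacci exactly when [n] is odd, whence
   [sqrt5 ^+ n.+1] there. *)
rewrite -signr_odd; case: ifP => [n_even|/negbFE n_odd].
  rewrite rmorphM /= ratr_sign_sum (negbTE n_even).
  apply: (@eq_scaled_sum _ (sqrt5 ^+ n)) => [i|].
    by rewrite binet_fibz binet_lucasz exprMn; ring.
  by rewrite sqrt5_exp (negbTE n_even) rmorphXn /= r5 /= divn2 !mul1r.
rewrite rmorphM /= ratr_sign_sum n_odd.
apply: (@eq_scaled_sum _ (sqrt5 ^+ n.+1)) => [i|].
  by rewrite !binet_fibz exprMn ?exprS; ring.
rewrite sqrt5_exp rmorphN rmorphXn /= r5 /= n_odd mul1r mulN1r.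
by have -> : ((n + 1) %/ 2 = n.+1./2)%N by lia.
Qed.
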